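(* Let $n\geq 3$. Then there is a one-to-one correspondence between the isomorphism classes of the finite Abelian subgroups of $B_n/[P_n,P_n]$ and the isomorphism classes of the Abelian subgroups of $S_n$ of odd order, given by equality of isomorphism classes: a finite Abelian group is isomorphic to a subgroup of $B_n/[P_n,P_n]$ if and only if it has odd order and is isomorphic to a subgroup of $S_n$.
   Context: $B_n$ is the Artin braid group with generators $\sigma_1,\ldots,\sigma_{n-1}$ and relations $\sigma_i\sigma_j=\sigma_j\sigma_i$ for $|i-j|\geq 2$, and $\sigma_{i+1}\sigma_i\sigma_{i+1}=\sigma_i\sigma_{i+1}\sigma_i$ for $1\leq i\leq n-2$. $S_n$ is the symmetric group. $P_n$ is the pure braid group, i.e. the kernel of the homomorphism $\sigma\colon B_n\to S_n$ with $\sigma(\sigma_i)=(i,i+1)$, and $[P_n,P_n]$ is its commutator subgroup. *)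

(* Defs.v *)
From HB Require Import structures.
From mathcomp Require Import all_boot all_fingroup.
From mathcomp Require Import generic_quotient zify.
From mathcomp Require Import boolp classical_sets.
Set Implicit Arguments.
Unset Strict Implicit.
Unset Printing Implicit Defensive.

Local Open Scope classical_set_scope.
Local Open Scope quotient_scope.
Local Open Scope group_scope.

Section Subgroups.
Variable G : groupType.
Implicit Types (A H K N : set G).

Record is_subgroup H : Prop := IsSubgroup {
  is_subgroup1 : H 1;
  is_subgroupM : forall x y, H x -> H y -> H (x * y);
  is_subgroupV : forall x, H x -> H x^-1 }.

Definition is_normal N : Prop :=
  is_subgroup N /\ forall x y, N x -> N (x ^ y).

Definition generated A : set G :=
  \bigcap_(H in [set H | is_subgroup H /\ A `<=` H]) H.

Definition commutators H K : set G :=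
  [set z | exists x y, [/\ H x, K y & z = [~ x, y]]].

Definition derived H : set G := generated (commutators H H).

Lemma generated_subgroup A : is_subgroup (generated A).
Proof.
split; first by move=> H [[]].
- move=> x y Ax Ay H HA; case: (HA) => -[_ HM _] _.
  by apply: HM; [exact: Ax | exact: Ay].
- by move=> x Ax H HA; case: (HA) => -[_ _ HV] _; apply: HV; apply: Ax.
Qed.

Lemma generated_normal A :
  (forall x y, A x -> A (x ^ y)) -> is_normal (generated A).
Proof.
move=> AJ; split=> [|x y Ax]; first exact: generated_subgroup.
move=> H [[H1 HM HV] AH].
apply: (Ax [set z | H (z ^ y)]); split; first split=> /=.
- by rewrite conj1g.
- by move=> u v Hu Hv; rewrite conjMg; apply: HM.
- by move=> u Hu; rewrite conjVg; apply: HV.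
- by move=> u Au /=; apply/AH/AJ.
Qed.

Lemma derived_normal H : is_normal H -> is_normal (derived H).
Proof.
case=> _ HJ; apply: generated_normal => _ y [u [v [Hu Hv ->]]].
by exists (u ^ y), (v ^ y); split; [exact: HJ | exact: HJ | rewrite conjRg].
Qed.

End Subgroups.

Definition kernel (G H : groupType) (f : G -> H) : set G := [set x | f x = 1].

Lemma kernel_normal (G H : groupType) (f : UMagmaMorphism.type G H) :
  is_normal (kernel f).
Proof.
split; first split; rewrite /kernel /=.
- exact: gmulf1.
- by move=> x y fx fy; rewrite gmulfM fx fy mulg1.
- by move=> x fx; rewrite gmulfV fx invg1.
- by move=> x y fx; rewrite gmulfJ fx conj1g.
Qed.

(* A multiplicative map between groups is automatically a group morphism. *)
Definition isomorphic_to_subgroup (A G : groupType) : Prop :=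
  exists H : set G, is_subgroup H /\
    exists f : {multiplicative A -> G}, injective f /\ range f = H.

Section QuotientGroup.
Variable G : groupType.

Record normalSubgroup := NormalSubgroup {
  normal_set : set G;
  normal_setP : is_normal normal_set }.

Variable N : normalSubgroup.
Implicit Types x y z : G.

Definition coset_rel : rel G := fun x y => `[< normal_set N (x^-1 * y) >].

Let N1 : normal_set N 1. Proof. by have [[h _ _] _] := normal_setP N. Qed.
Let NM x y : normal_set N x -> normal_set N y -> normal_set N (x * y).
Proof. by have [[_ h _] _] := normal_setP N; apply: h. Qed.
Let NV x : normal_set N x -> normal_set N x^-1.
Proof. by have [[_ _ h] _] := normal_setP N; apply: h. Qed.
Let NJ x y : normal_set N x -> normal_set N (x ^ y).
Proof. by have [_ h] := normal_setP N; apply: h. Qed.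

Lemma coset_rel_refl : reflexive coset_rel.
Proof. by move=> x; apply/asboolP; rewrite mulVg. Qed.

Lemma coset_rel_sym : symmetric coset_rel.
Proof.
suff h x y : coset_rel x y -> coset_rel y x by move=> x y; apply/idP/idP; apply: h.
by move=> /asboolP/NV; rewrite invgM invgK => ?; apply/asboolP.
Qed.

Lemma coset_rel_trans : transitive coset_rel.
Proof.
move=> y x z /asboolP xy /asboolP yz; apply/asboolP.
by have := NM xy yz; rewrite -mulgA mulKVg.
Qed.

Canonical coset_equiv :=
  EquivRel coset_rel coset_rel_refl coset_rel_sym coset_rel_trans.

Definition quotient_group := {eq_quot coset_rel}.
HB.instance Definition _ := Choice.on quotient_group.
HB.instance Definition _ := EqQuotient.on quotient_group.

Definition quot_proj (x : G) : quotient_group := \pi x.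

Lemma quot_projP x y : quot_proj x = quot_proj y <-> normal_set N (x^-1 * y).
Proof. by split=> [/eqmodP/asboolP | h] //; apply/eqmodP/asboolP. Qed.

Definition quot_one : quotient_group := quot_proj 1.
Definition quot_mul (u v : quotient_group) := quot_proj (repr u * repr v).
Definition quot_inv (u : quotient_group) := quot_proj (repr u)^-1.

Lemma quot_proj_ind (P : quotient_group -> Prop) :
  (forall x, P (quot_proj x)) -> forall u, P u.
Proof. by move=> h u; rewrite -(reprK u); apply: h. Qed.

Let reprN x : normal_set N (x^-1 * repr (quot_proj x)).
Proof. by apply/quot_projP; rewrite /quot_proj reprK. Qed.

Lemma quot_mulE x y : quot_mul (quot_proj x) (quot_proj y) = quot_proj (x * y).
Proof.
apply/esym/quot_projP; set x' := repr _; set y' := repr _.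
have -> : (x * y)^-1 * (x' * y') = (x^-1 * x') ^ y * (y^-1 * y').
  by rewrite conjgE invgM -!mulgA mulKVg.
by apply: NM; [apply: NJ |]; apply: reprN.
Qed.

Lemma quot_invE x : quot_inv (quot_proj x) = quot_proj x^-1.
Proof.
apply/quot_projP; rewrite invgK; set x' := repr _.
have -> : x' * x^-1 = (x^-1 * x') ^ x^-1.
  by rewrite conjgE invgK -mulgA mulKVg.
exact/NJ/reprN.
Qed.

Lemma quot_mulA : associative quot_mul.
Proof.
elim/quot_proj_ind=> x; elim/quot_proj_ind=> y; elim/quot_proj_ind=> z.
by rewrite !quot_mulE mulgA.
Qed.
Lemma quot_mul1g : left_id quot_one quot_mul.
Proof. by elim/quot_proj_ind=> x; rewrite quot_mulE mul1g. Qed.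
Lemma quot_mulg1 : right_id quot_one quot_mul.
Proof. by elim/quot_proj_ind=> x; rewrite quot_mulE mulg1. Qed.
Lemma quot_mulVg : left_inverse quot_one quot_inv quot_mul.
Proof. by elim/quot_proj_ind=> x; rewrite quot_invE quot_mulE mulVg. Qed.
Lemma quot_mulgV : right_inverse quot_one quot_inv quot_mul.
Proof. by elim/quot_proj_ind=> x; rewrite quot_invE quot_mulE mulgV. Qed.

HB.instance Definition _ := isGroup.Build quotient_group
  quot_mulA quot_mul1g quot_mulg1 quot_mulVg quot_mulgV.

Lemma quot_proj_morphism : monoid_morphism quot_proj.
Proof. by split=> // x y; rewrite -quot_mulE. Qed.
HB.instance Definition _ :=
  isUMagmaMorphism.Build G quotient_group quot_proj quot_proj_morphism.

End QuotientGroup.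

Section BraidGroup.
Variable n : nat.

(* The index i : 'I_n.-1 is counted from 0, so it stands for sigma_(i+1);
   the letter (i, false) is that generator and (i, true) its inverse. *)
Definition braid_letter := ('I_n.-1 * bool)%type.
Definition braid_word := seq braid_letter.
Implicit Types (i j : 'I_n.-1) (u v w : braid_word).

Definition letter_inv (l : braid_letter) : braid_letter := (l.1, ~~ l.2).
Definition word_inv w : braid_word := rev (map letter_inv w).

Local Notation s i := ((i, false) : braid_letter).

Inductive braid_eq : braid_word -> braid_word -> Prop :=
| braid_eq_refl u : braid_eq u u
| braid_eq_sym u v : braid_eq u v -> braid_eq v u
| braid_eq_trans u v w : braid_eq u v -> braid_eq v w -> braid_eq u w
| braid_eq_cat u u' v v' :
    braid_eq u u' -> braid_eq v v' -> braid_eq (u ++ v) (u' ++ v')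
| braid_eq_cancel l : braid_eq [:: l; letter_inv l] [::]
| braid_eq_far i j : (i.+2 <= j)%N -> braid_eq [:: s i; s j] [:: s j; s i]
| braid_eq_near i j : j = i.+1 :> nat ->
    braid_eq [:: s j; s i; s j] [:: s i; s j; s i].

Definition braid_rel : rel braid_word := fun u v => `[< braid_eq u v >].

Lemma braid_rel_refl : reflexive braid_rel.
Proof. by move=> u; apply/asboolP; constructor. Qed.
Lemma braid_rel_sym : symmetric braid_rel.
Proof.
by move=> u v; apply/idP/idP => /asboolP h; apply/asboolP; apply: braid_eq_sym.
Qed.
Lemma braid_rel_trans : transitive braid_rel.
Proof.
move=> v u w /asboolP uv /asboolP vw; apply/asboolP.
exact: braid_eq_trans vw.
Qed.

Canonical braid_equiv :=
  EquivRel braid_rel braid_rel_refl braid_rel_sym braid_rel_trans.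

Definition braid_group := {eq_quot braid_rel}.
HB.instance Definition _ := Choice.on braid_group.
HB.instance Definition _ := EqQuotient.on braid_group.

Definition braid_of w : braid_group := \pi w.

Lemma braid_ofP u v : braid_of u = braid_of v <-> braid_eq u v.
Proof. by split=> [/eqmodP/asboolP | h] //; apply/eqmodP/asboolP. Qed.

Lemma braid_of_ind (P : braid_group -> Prop) :
  (forall w, P (braid_of w)) -> forall x, P x.
Proof. by move=> h x; rewrite -(reprK x); apply: h. Qed.

Lemma repr_braid_of w : braid_eq (repr (braid_of w)) w.
Proof. by apply/braid_ofP; rewrite /braid_of reprK. Qed.

Definition braid_one : braid_group := braid_of [::].
Definition braid_mul (x y : braid_group) := braid_of (repr x ++ repr y).
Definition braid_inv (x : braid_group) := braid_of (word_inv (repr x)).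

Lemma braid_mulE u v : braid_mul (braid_of u) (braid_of v) = braid_of (u ++ v).
Proof. by apply/braid_ofP/braid_eq_cat; apply: repr_braid_of. Qed.

Lemma letter_invK : involutive letter_inv.
Proof. by case=> i b; rewrite /letter_inv negbK. Qed.

Lemma word_invK : involutive word_inv.
Proof.
by move=> w; rewrite /word_inv map_rev revK mapK //; apply: letter_invK.
Qed.

Lemma braid_eq_mulwV w : braid_eq (w ++ word_inv w) [::].
Proof.
elim: w => [|l w IHw]; first exact: braid_eq_refl.
rewrite /word_inv map_cons rev_cons -cats1 -/(word_inv w) cat_cons catA.
apply: braid_eq_trans (braid_eq_cancel l).
apply: (@braid_eq_cat [:: l] [:: l] _ [:: letter_inv l]) (braid_eq_refl _) _.
exact: (@braid_eq_cat _ [::]) IHw (braid_eq_refl _).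
Qed.

Lemma braid_mulA : associative braid_mul.
Proof.
elim/braid_of_ind=> u; elim/braid_of_ind=> v; elim/braid_of_ind=> w.
by rewrite !braid_mulE catA.
Qed.
Lemma braid_mul1g : left_id braid_one braid_mul.
Proof. by elim/braid_of_ind=> w; rewrite braid_mulE. Qed.
Lemma braid_mulg1 : right_id braid_one braid_mul.
Proof. by elim/braid_of_ind=> w; rewrite braid_mulE cats0. Qed.
Lemma braid_mulgV : right_inverse braid_one braid_inv braid_mul.
Proof.
move=> x; rewrite -[X in braid_mul X _](reprK x) -/(braid_of _) braid_mulE.
exact/braid_ofP/braid_eq_mulwV.
Qed.
Lemma braid_mulVg : left_inverse braid_one braid_inv braid_mul.
Proof.
move=> x; rewrite -[X in braid_mul _ X](reprK x) -/(braid_of _) braid_mulE.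
apply/braid_ofP; rewrite -[X in _ ++ X]word_invK.
exact: braid_eq_mulwV.
Qed.

HB.instance Definition _ := isGroup.Build braid_group
  braid_mulA braid_mul1g braid_mulg1 braid_mulVg braid_mulgV.

Definition braid_gen i : braid_group := braid_of [:: s i].

Lemma succ_lt_strands i : (i.+1 < n)%N.
Proof. by rewrite -ltn_predRL. Qed.

Definition letter_perm (l : braid_letter) : 'S_n :=
  tperm (Ordinal (ltnW (succ_lt_strands l.1))) (Ordinal (succ_lt_strands l.1)).

(* A transposition is its own inverse, so the sign of a letter is irrelevant. *)
Definition word_perm w : 'S_n := \prod_(l <- w) letter_perm l.

Definition braid_perm (x : braid_group) : 'S_n := word_perm (repr x).

Lemma word_perm_cat u v : word_perm (u ++ v) = word_perm u * word_perm v.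
Proof. exact: big_cat. Qed.

Lemma word_perm_eq u v : braid_eq u v -> word_perm u = word_perm v.
Proof.
elim=> {u v} //.
- by move=> u v w _ -> _ ->.
- by move=> u u' v v' _ uu' _ vv'; rewrite !word_perm_cat uu' vv'.
- by move=> l; rewrite /word_perm !big_cons big_nil mulg1 tperm2.
- move=> i j ij; rewrite /word_perm !big_cons big_nil !mulg1.
  apply: (mulgI (letter_perm (s j))^-1); rewrite mulKg -[LHS]conjgE.
  rewrite tpermJ !tpermD // -(inj_eq val_inj) /=; lia.
- move=> i j ij; rewrite /word_perm !big_cons big_nil !mulg1.
  rewrite /letter_perm /=.
  have -> : Ordinal (ltnW (succ_lt_strands j)) = Ordinal (succ_lt_strands i).
    exact/val_inj.
  set a := Ordinal _; set b := Ordinal _; set c := Ordinal _.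
  have ab : a != b by rewrite -(inj_eq val_inj) /=; lia.
  have bc : b != c by rewrite -(inj_eq val_inj) /=; lia.
  have ac : a != c by rewrite -(inj_eq val_inj) /=; lia.
  have tJ (x y z t : 'I_n) : tperm x y * (tperm z t * tperm x y)
      = tperm (tperm x y z) (tperm x y t) by rewrite -tpermJ conjgE tpermV.
  by rewrite !tJ tpermR tpermL !tpermD // eq_sym.
Qed.

Lemma braid_permE w : braid_perm (braid_of w) = word_perm w.
Proof. exact/word_perm_eq/repr_braid_of. Qed.

Lemma braid_perm_gen i : braid_perm (braid_gen i) = letter_perm (s i).
Proof. by rewrite braid_permE /word_perm big_seq1. Qed.

Lemma braid_perm_morphism : monoid_morphism braid_perm.
Proof.
split; first by rewrite braid_permE /word_perm big_nil.
elim/braid_of_ind=> u; elim/braid_of_ind=> v.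
by rewrite -[_ * _]/(braid_mul _ _) braid_mulE !braid_permE word_perm_cat.
Qed.

HB.instance Definition _ :=
  isUMagmaMorphism.Build braid_group 'S_n braid_perm braid_perm_morphism.

Definition pure_braid : set braid_group := kernel braid_perm.

Lemma derived_pure_braid_normal : is_normal (derived pure_braid).
Proof. exact/derived_normal/kernel_normal. Qed.

Definition derived_pure_braid : normalSubgroup braid_group :=
  NormalSubgroup derived_pure_braid_normal.

Definition braid_mod_derived := quotient_group derived_pure_braid.
HB.instance Definition _ := Group.on braid_mod_derived.

End BraidGroup.

(* Main.v *)
Require Import Defs.
From HB Require Import structures.
From mathcomp Require Import all_boot all_fingroup.
From mathcomp Require Import cyclic pgroup generic_quotient.
From mathcomp Require Import ssralg ssrnum ssrint.
From mathcomp Require Import zify ring boolp classical_sets.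

(* Attach to a braid its permutation and, for each pair of strands, the signed
   number of crossings between them. This gives a crossed homomorphism to
   Z^(n choose 2); on the pure braid group P it is twice the linking numbers.
   Since P is generated by the conjugates of the sigma_i^2 (the relations
   sigma_i^2 = 1 turn the braid presentation into the Coxeter presentation of
   S_n), and modulo [P, P] such a conjugate depends only on the pair of strands
   it twists, B_n/[P, P] embeds into the semidirect product of Z^(n choose 2)
   and S_n. Its image consists of the (v, p) such that v modulo 2 is the
   indicator function of the inversions of p.

   Torsion elements of P/[P, P] are trivial, and an involution would swap two
   strands a, b, whose crossing number would be both zero and odd. Hence a
   finite subgroup embeds into S_n and has odd order. Conversely an odd-order subgroup
   of S_n preserves an orientation of the pairs of strands; measuring its
   disagreement with the standard order by a 0-1 function d on pairs, the
   elements (h.d - d, h) lie in the image and form a copy of the subgroup. *)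

Set Implicit Arguments.
Unset Strict Implicit.
Unset Printing Implicit Defensive.

Local Open Scope classical_set_scope.
Local Open Scope group_scope.

(** * Normal form of words under the Coxeter relations *)

Section CoxeterRelations.
Variables (G : groupType) (N : nat) (g : nat -> G).
Hypothesis gg : forall k, g k * g k = 1.
Hypothesis g_far : forall k l, (k.+2 <= l)%N -> commute (g k) (g l).
Hypothesis g_near :
  forall k, (k.+1 < N)%N -> g k.+1 * g k * g k.+1 = g k * g k.+1 * g k.

Definition descent k d : G := \prod_(i < d) g (k - i).

Lemma descentS k d : descent k d.+1 = descent k d * g (k - d).
Proof. by rewrite /descent big_ord_recr. Qed.

Lemma descent_commute k d i : (i.+1 + d <= k)%N -> commute (g i) (descent k d).
Proof.
elim: d => [|d IHd] le_k; first by rewrite /descent big_ord0; apply: commute1.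
rewrite descentS; apply: commuteM; first by apply: IHd; lia.
by apply: g_far; lia.
Qed.

(** Moving left, [g i] commutes with the factors of index below [i - 1], the near relation turns
    [g i * g (i - 1) * g i] into [g (i - 1) * g i * g (i - 1)], and the new [g (i - 1)] commutes
    with the factors of index above [i]. *)
Lemma descent_shift k d i : (d <= k.+1)%N -> (k < N)%N ->
  (k.+1 < i + d)%N -> (i <= k)%N -> descent k d * g i = g i.-1 * descent k d.
Proof.
move=> + kN; elim: d => [|d IHd] dk di ik; first by lia.
have [i1|i1] := eqVneq i (k - d).+1; last first.
  rewrite descentS -mulgA [g _ * g i]g_far; last by lia.
  by rewrite mulgA IHd ?mulgA //; lia.
case: d => [|d] in IHd dk di i1 *; first by lia.
rewrite i1 !descentS /=; have -> : (k - d = (k - d.+1).+1)%N by lia.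
rewrite -!mulgA (mulgA (g _.+1)) g_near; last by lia.
by rewrite !mulgA -descent_commute //; lia.
Qed.

(* The descents represent the cosets of <g 0, ..., g (k - 1)> in
   <g 0, ..., g k>. *)
Lemma word_descent k (w : seq nat) : (k < N)%N -> all (fun i => i < k.+1)%N w ->
  exists u d, [/\ (d <= k.+1)%N, all (fun i => i < k)%N u &
    \prod_(i <- w) g i = \prod_(i <- u) g i * descent k d].
Proof.
move=> kN; elim/last_ind: w => [|w i IHw].
  by exists [::], 0; rewrite /descent big_ord0 big_nil mulg1.
rewrite all_rcons => /andP[ik /IHw [u [d [dk uk]]]].
rewrite -cats1 big_cat big_seq1 /= => ->.
(* A nonempty [descent k d] ends with index [k - d + 1]. The new letter passes through the descent
   if [i + d < k], lengthens it if [i + d = k], cancels its last factor if [i + d = k + 1], and is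
   shifted otherwise. *)
have [di|di|di] := ltngtP (i + d)%N k.
- exists (rcons u i), d; split; rewrite ?all_rcons ?uk ?andbT //; first by lia.
  by rewrite -cats1 big_cat big_seq1 -!mulgA descent_commute //; lia.
- have [di'|di'] := eqVneq (i + d)%N k.+1; last first.
    exists (rcons u i.-1), d; split; rewrite ?all_rcons ?uk ?andbT //.
      by lia.
    by rewrite -cats1 big_cat big_seq1 -!mulgA descent_shift //; lia.
  exists u, d.-1; split=> //; first by lia.
  case: d => [|d] in di di' dk *; first by lia.
  by rewrite descentS -!mulgA (_ : (k - d)%N = i) ?gg ?mulg1 //; lia.
- exists u, d.+1; split=> //; first by lia.
  by rewrite descentS -mulgA; congr (_ * (_ * g _)); lia.
Qed.

End CoxeterRelations.

(** * Words of adjacent transpositions *)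

Section AdjacentTranspositions.
Variable n : nat.

(** Indices out of range give the identity, so that letters are plain natural numbers, as in
    [word_descent]. *)
Definition adj (k : nat) : 'S_n :=
  oapp (fun i : 'I_n.-1 => letter_perm (i, false)) 1 (insub k).

Lemma adjE k (k1 : (k < n)%N) (k2 : (k.+1 < n)%N) :
  adj k = tperm (Ordinal k1) (Ordinal k2).
Proof.
rewrite /adj insubT; first by lia.
by move=> ?; rewrite /= /letter_perm; congr tperm; apply: val_inj.
Qed.

Lemma adj_fix k (a : 'I_n) : a != k :> nat -> a != k.+1 :> nat -> adj k a = a.
Proof.
rewrite /adj; case: insubP => [i _ <- ak ak1|_ _ _] /=; last by rewrite perm1.
by rewrite tpermD // -(inj_eq val_inj) /= eq_sym.
Qed.

Lemma adjL k (a : 'I_n) : (k.+1 < n)%N -> a = k.+1 :> nat -> adj k a = k :> nat.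
Proof.
move=> k2 ak; rewrite (adjE (ltnW k2) k2).
by rewrite (_ : a = Ordinal k2) ?tpermR //; apply: val_inj.
Qed.

Lemma word_adj_fix k (w : seq nat) (a : 'I_n) :
  all (fun i => i < k)%N w -> (k < a)%N -> (\prod_(i <- w) adj i) a = a.
Proof.
move=> + ka; elim: w => [|i w IHw] /=; first by rewrite big_nil perm1.
by case/andP=> ik /IHw h; rewrite big_cons permM adj_fix ?h //; lia.
Qed.

Lemma descent_adj k d (a : 'I_n) : (d <= k.+1)%N -> a = k.+1 :> nat ->
  descent adj k d a = (k.+1 - d)%N :> nat.
Proof.
move=> + ak; elim: d => [|d IHd] dk.
  by rewrite /descent big_ord0 perm1 subn0.
have := ltn_ord a; rewrite descentS permM => an; rewrite adjL //; lia.
Qed.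

Lemma descent_adj_fix k d (a : 'I_n) : (k.+1 < a)%N -> descent adj k d a = a.
Proof.
move=> ak; elim: d => [|d IHd]; first by rewrite /descent big_ord0 perm1.
by rewrite descentS permM IHd adj_fix //; lia.
Qed.

(** The descent taking position [k + 1] to its image under [p] is split off; what remains fixes
    position [k + 1] as well, and the induction applies. *)
Lemma perm_word k (p : 'S_n) : (forall a : 'I_n, (k < a)%N -> p a = a) ->
  exists2 w, all (fun i => i < k)%N w & p = \prod_(i <- w) adj i.
Proof.
elim: k p => [|k IHk] p.
  move=> fix_p; exists [::] => //; rewrite big_nil.
  apply/permP => a; rewrite perm1.
  have [a0|a0] := posnP a; last exact: fix_p.
  have [pa0|pa0] := posnP (p a); last exact: perm_inj (fix_p _ pa0).
  by apply: val_inj; rewrite /= pa0 a0.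
move=> fix_p; have [kn|kn] := ltnP k.+1 n; last first.
  have [a ka|w wk ->] := IHk p; last first.
    by exists w => //; apply: sub_all wk => i /ltnW.
  by apply: fix_p; have := ltn_ord a; lia.
pose a := Ordinal kn; pose d := (k.+1 - p a)%N.
have pa : (p a <= k.+1)%N.
  by rewrite leqNgt; apply/negP => /[dup] /fix_p /perm_inj ->; rewrite ltnn.
have [b kb|w wk pE] := IHk (p * (descent adj k d)^-1).
  rewrite permM; apply: (canLR (permK _)).
  have [->|ba] := eqVneq b a.
    by apply/val_inj; rewrite /= descent_adj /d ?subKn ?leq_subr.
  have kb1 : (k.+1 < b)%N by move: ba; rewrite -(inj_eq val_inj) /=; lia.
  by rewrite descent_adj_fix ?fix_p.
exists (w ++ [seq (k - i)%N | i <- iota 0 d]).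
  rewrite all_cat (sub_all _ wk) => [|i /ltnW //].
  apply/allP => _ /mapP[i _ ->].
  by rewrite ltnS leq_subr.
rewrite big_cat -pE /= big_map -[X in iota _ X]subn0 -/(index_iota 0 d).
by rewrite big_mkord mulgVK.
Qed.

End AdjacentTranspositions.

(** * Generated subgroups and quotients *)

Section Subgroups.
Variable G : groupType.
Implicit Types (A H : set G) (x y : G).

Lemma mem_generated A x : A x -> Defs.generated A x.
Proof. by move=> Ax H [_]; apply. Qed.

Lemma generated_sub A H : is_subgroup H -> A `<=` H -> Defs.generated A `<=` H.
Proof. by move=> Hs AH x; apply; split. Qed.

Lemma subgroup_prod H I (r : seq I) (F : I -> G) : is_subgroup H ->
  (forall i, H (F i)) -> H (\prod_(i <- r) F i).
Proof. by case=> H1 HM _ HF; elim/big_ind: _ => // *; apply: HM. Qed.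

Lemma quot_proj_eq1 (N : normalSubgroup G) x :
  quot_proj N x = 1 <-> normal_set N x.
Proof.
rewrite -[1]/(quot_proj N 1); split=> [/esym/quot_projP|Nx].
  by rewrite invg1 mul1g.
by apply/esym/quot_projP; rewrite invg1 mul1g.
Qed.

End Subgroups.

(** * Generation of the pure braid group by conjugates of squares *)

Section BraidGroupTheory.
Variable n : nat.
Local Notation B := (braid_group n).
Local Notation P := (@pure_braid n).
Implicit Types (x y z : B) (k l : nat) (S T : {set 'I_n}).

Definition sigma k : B := oapp (@braid_gen n) 1 (insub k).

Lemma braid_of_cat u v : braid_of (u ++ v) = braid_of u * braid_of v :> B.
Proof. by rewrite -[_ * _]/(braid_mul _ _) braid_mulE. Qed.

Lemma braid_of_letter (i : 'I_n.-1) b :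
  braid_of [:: (i, b)] = if b then (sigma i)^-1 else sigma i.
Proof.
rewrite /sigma valK /=; case: b => //; apply/(mulgI (braid_gen i)).
by rewrite mulgV -braid_of_cat; apply/braid_ofP/(braid_eq_cancel (i, false)).
Qed.

Lemma braid_ind (C : set B) :
  is_subgroup C -> (forall k, C (sigma k)) -> forall x, C x.
Proof.
case=> C1 CM CV Csigma; elim/braid_of_ind; elim=> [|[i b] w IHw] //.
rewrite -cat1s braid_of_cat; apply: CM => //.
by rewrite braid_of_letter; case: b; [apply: CV|].
Qed.

Lemma sigma_far k l : (k.+2 <= l)%N -> commute (sigma k) (sigma l).
Proof.
rewrite /sigma => kl; case: insubP => [i _ ik|_]; last first.
  exact/commute_sym/commute1.
case: insubP => [j _ jl|_]; last exact/commute1.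
rewrite /commute /= /braid_gen -!braid_of_cat; apply/braid_ofP/braid_eq_far.
by rewrite ik jl.
Qed.

Lemma sigma_near k : (k.+1 < n.-1)%N ->
  sigma k.+1 * sigma k * sigma k.+1 = sigma k * sigma k.+1 * sigma k.
Proof.
move=> kn; rewrite /sigma !insubT; first by lia.
move=> kn'; rewrite /= /braid_gen -!braid_of_cat.
exact/braid_ofP/braid_eq_near.
Qed.

Lemma perm_sigma k : braid_perm (sigma k) = adj n k.
Proof.
rewrite /sigma /adj; case: insubP => [i _ _|_] /=; first exact: braid_perm_gen.
exact: gmulf1.
Qed.

Lemma adj_adj k : adj n k * adj n k = 1.
Proof.
by rewrite /adj; case: insubP => [i _ _|_] /=; rewrite ?mulg1 ?tperm2.
Qed.

Lemma braid_perm1 : braid_perm (1 : B) = 1.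
Proof. exact: gmulf1. Qed.

Lemma braid_permM x y : braid_perm (x * y) = braid_perm x * braid_perm y.
Proof. exact: gmulfM. Qed.

Lemma braid_permV x : braid_perm x^-1 = (braid_perm x)^-1.
Proof. exact: gmulfV. Qed.

Lemma pure_subgroup : is_subgroup P.
Proof. by have [] := kernel_normal (@braid_perm n). Qed.

Lemma pureJ x y : P x -> P (x ^ y).
Proof. by have [_ h] := kernel_normal (@braid_perm n); apply: h. Qed.

Lemma pure_sigma2 k : P (sigma k * sigma k).
Proof. by rewrite /pure_braid /= /kernel /= braid_permM perm_sigma adj_adj. Qed.

Definition sigma2_conjugates : set B :=
  [set z | exists k x, z = (sigma k * sigma k) ^ x].

Lemma sigma2_conjugates_normal : is_normal (Defs.generated sigma2_conjugates).
Proof.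
apply: generated_normal => _ y [k [x ->]].
by exists k, (x * y); rewrite conjgM.
Qed.

(** In the quotient by the normal closure of the squares, the images [g k] of the generators satisfy
    the Coxeter relations. *)
Let N := NormalSubgroup sigma2_conjugates_normal.
Let q : B -> _ := quot_proj N.
Let g k := q (sigma k).

Let qM x y : q (x * y) = q x * q y. Proof. exact: gmulfM. Qed.

Let q1 : q 1 = 1. Proof. exact: gmulf1. Qed.
Let qV x : q x^-1 = (q x)^-1. Proof. exact: gmulfV. Qed.

Let sigma2_conjugates_pure : normal_set N `<=` P.
Proof.
apply: generated_sub pure_subgroup _ => _ [k [x ->]].
exact/pureJ/pure_sigma2.
Qed.

Let perm_q x y : q x = q y -> braid_perm x = braid_perm y.
Proof.
move/quot_projP/sigma2_conjugates_pure.
rewrite /pure_braid /= /kernel /= braid_permM braid_permV => h.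
by apply: (mulgI (braid_perm x)^-1); rewrite h mulVg.
Qed.

Let q_prod w : q (\prod_(k <- w) sigma k) = \prod_(k <- w) g k.
Proof. exact: gmulf_prod. Qed.

Lemma perm_prod (w : seq nat) :
  braid_perm (\prod_(k <- w) sigma k) = \prod_(k <- w) adj n k.
Proof.
by rewrite [LHS]gmulf_prod; apply: eq_bigr => k _; apply: perm_sigma.
Qed.

Let gg k : g k * g k = 1.
Proof.
rewrite -qM; apply/quot_proj_eq1; apply: mem_generated.
rewrite /sigma2_conjugates /=.
by exists k, 1; rewrite conjg1.
Qed.

Let q_word x :
  exists2 w, all (fun k => k < n.-1)%N w & q x = \prod_(k <- w) g k.
Proof.
pose C := [set x | exists2 w, all (fun k => k < n.-1)%N w
                            & q x = \prod_(k <- w) g k].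
apply: (@braid_ind C); first split; rewrite /C /=.
- by exists [::]; rewrite // big_nil q1.
- move=> y z [u un qy] [v vn qz]; exists (u ++ v); first by rewrite all_cat un.
  by rewrite qM qy qz big_cat.
- move=> y [w wn qy]; exists (rev w); first by rewrite all_rev.
  rewrite qV qy.
  elim: w {wn qy} => [|k w IHw]; first by rewrite !big_nil invg1.
  rewrite rev_cons -cats1 big_cons big_cat big_seq1 invgM IHw; congr (_ * _).
  by apply: (mulgI (g k)); rewrite mulgV gg.
- move=> k; have [kn|kn] := ltnP k n.-1.
    by exists [:: k]; rewrite ?big_seq1 //= kn.
  exists [::]; rewrite // big_nil /sigma insubF ?ltnNge ?kn //= q1.
Qed.

(** In the induction step, the word is modulo [N] a word in letters below [k] times a descent. Those
    letters fix position [k + 1], which the descent moves to [k + 1 - d], so purity forces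
    [d = 0]. *)
Lemma pure_word k (w : seq nat) : (k <= n.-1)%N -> all (fun i => i < k)%N w ->
  P (\prod_(k <- w) sigma k) -> normal_set N (\prod_(k <- w) sigma k).
Proof.
have g_far i j : (i.+2 <= j)%N -> commute (g i) (g j).
  by rewrite /commute -!qM => /sigma_far ->.
have g_near i : (i.+1 < n.-1)%N ->
    g i.+1 * g i * g i.+1 = g i * g i.+1 * g i.
  by move=> /sigma_near h; rewrite /g -!qM h.
elim: k w => [|k IHk] w kn wk Pw.
  by case: w wk {Pw} => // _; rewrite big_nil; case: (normal_setP N) => [[]].
have [u [d [dk uk wE]]] := word_descent gg g_far g_near kn wk.
have yE : \prod_(i <- u) g i * descent g k d =
    q (\prod_(i <- u) sigma i * descent sigma k d).
  rewrite qM q_prod; congr (_ * _).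
  by rewrite /q [RHS]gmulf_prod.
have d0 : d = 0%N.
  have kn1 : (k.+1 < n)%N by lia.
  have := congr1 (fun p : 'S_n => p (Ordinal kn1) : nat) Pw.
  rewrite (perm_q (etrans (q_prod w) (etrans wE yE))) perm1.
  rewrite braid_permM perm_prod permM (word_adj_fix uk) //.
  rewrite (_ : braid_perm _ = descent (adj n) k d); last first.
    by rewrite [LHS]gmulf_prod; apply: eq_bigr => i _; apply: perm_sigma.
  by rewrite descent_adj //=; lia.
move: yE; rewrite -wE -q_prod d0 /descent big_ord0 mulg1 => yE.
apply/quot_proj_eq1; rewrite -/(q _) yE.
apply: (proj2 (quot_proj_eq1 N _)); apply: (IHk) => //; first exact: ltnW.
exact: etrans (esym (perm_q yE)) Pw.
Qed.

Lemma pure_generated x : P x -> Defs.generated sigma2_conjugates x.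
Proof.
have [w wn] := q_word x; rewrite -q_prod => /[dup] qx /perm_q px Px.
suff: q x = 1 by move/quot_proj_eq1.
rewrite qx; apply: (proj2 (quot_proj_eq1 N _)); apply: pure_word wn _ => //.
exact: etrans (esym px) Px.
Qed.

End BraidGroupTheory.

(** * Crossing numbers of pairs of strands *)

Section LinkingNumbers.
Variable n : nat.
Local Notation B := (braid_group n).
Local Notation P := (@pure_braid n).
Implicit Types (x y z : B) (k l : nat) (S T : {set 'I_n}) (p : 'S_n).
Implicit Types (i j : 'I_n.-1) (u v w : braid_word n).

Definition strand i : 'I_n := Ordinal (ltnW (succ_lt_strands i)).
Definition next_strand i : 'I_n := Ordinal (succ_lt_strands i).
Definition strands i : {set 'I_n} := [set strand i; next_strand i]%SET.

Lemma strand_neq i : strand i != next_strand i.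
Proof. by rewrite -(inj_eq val_inj) /= ltn_eqF. Qed.

Lemma letter_permE i b : letter_perm (i, b) = tperm (strand i) (next_strand i).
Proof. by []. Qed.

Lemma imset_permM p p' S : (p * p') @: S = p' @: (p @: S).
Proof. by rewrite -imset_comp; apply: eq_imset => a; rewrite permM. Qed.

Lemma imset_perm1 S : (1 : 'S_n) @: S = S.
Proof. by rewrite (eq_imset (g := id)) ?imset_id // => a; rewrite perm1. Qed.

Lemma imset_perm_eq p S T : (p @: S == T) = (S == p^-1 @: T).
Proof.
apply/eqP/eqP => [<-|->]; first by rewrite -imset_permM mulgV imset_perm1.
by rewrite -imset_permM mulVg imset_perm1.
Qed.

Lemma imset_set2 (aT rT : finType) (f : aT -> rT) a b :
  f @: [set a; b]%SET = [set f a; f b]%SET.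
Proof. by rewrite imsetU1 imset_set1. Qed.

(* Strand [a] of a word is the one starting at position [a]; [word_lk w S] is
   the sum of the signs of the crossings between the two strands in [S], that
   is, twice their linking number when [w] is pure. *)
Fixpoint word_lk w S : int :=
  if w is l :: w' then
    ((-1) ^+ l.2 *+ (S == strands l.1) + word_lk w' (letter_perm l @: S))%R
  else 0%R.

Lemma word_lk_cat u v S :
  word_lk (u ++ v) S = (word_lk u S + word_lk v (word_perm u @: S))%R.
Proof.
elim: u S => [|l u IHu] S /=.
  by rewrite /word_perm big_nil imset_perm1 GRing.add0r.
by rewrite IHu /word_perm big_cons imset_permM GRing.addrA.
Qed.

Lemma word_lk_eq u v : braid_eq u v -> word_lk u =1 word_lk v.
Proof.
elim=> {u v} //.
- by move=> u v _ IH S.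
- by move=> u v w _ uv _ vw S; rewrite uv.
- move=> u u' v v' uu' IHu _ IHv S.
  by rewrite !word_lk_cat IHu IHv (word_perm_eq uu').
- move=> [i b] S /=; rewrite imset_perm_eq tpermV imset_set2 tpermL tpermR.
  by rewrite finset.setUC; case: b; case: eqP => _ /=.
- move=> i j ij S /=; rewrite !imset_perm_eq !tpermV !imset_set2.
  rewrite !tpermD -?(inj_eq val_inj) /=; lia.
- move=> i j ij S /=.
  have bE : strand j = next_strand i by apply: val_inj.
  rewrite !imset_perm_eq !tpermV /letter_perm /=.
  rewrite -!/(strand _) -!/(next_strand _).
  rewrite /strands bE !imset_set2.
  set a := strand i; set b := next_strand i; set c := next_strand j.
  have ab : a != b by rewrite -(inj_eq val_inj) /=; lia.
  have bc : b != c by rewrite -(inj_eq val_inj) /=; lia.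
  have ac : a != c by rewrite -(inj_eq val_inj) /=; lia.
  have [ba ca] : b != a /\ c != a by rewrite ![_ == a]eq_sym.
  rewrite !(tpermL, tpermR, tpermD ba ca, tpermD ac bc).
  (* Both sides sum the indicators of [{a, b}], [{a, c}] and [{b, c}], in opposite orders. *)
  by rewrite !GRing.addr0 [LHS]GRing.addrC -GRing.addrA [RHS]GRing.addrCA.
Qed.

Lemma strands_inversion i (a b : 'I_n) : a != b ->
  ([set a; b]%SET == strands i) =
    (a < b)%N (+) (letter_perm (i, false) a < letter_perm (i, false) b)%N.
Proof.
move=> ab.
have Ea : (a \in strands i) = (a == strand i) || (a == next_strand i).
  by rewrite !inE.
have Eb : (b \in strands i) = (b == strand i) || (b == next_strand i).
  by rewrite !inE.
have subE : ([set a; b]%SET == strands i) =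
    (a \in strands i) && (b \in strands i).
  rewrite eqEcard !cards2 ab strand_neq finset.subUset.
  by rewrite !finset.sub1set andbT.
rewrite subE Ea Eb letter_permE.
move: ab; rewrite -!(inj_eq val_inj) /=.
case: tpermP => [->|->|/eqP + /eqP]; case: tpermP => [->|->|/eqP + /eqP];
  rewrite -?(inj_eq val_inj) /=; lia.
Qed.

Definition lk x S : int := word_lk (repr x) S.

Lemma lkE w S : lk (braid_of w) S = word_lk w S.
Proof. exact/word_lk_eq/repr_braid_of. Qed.

Lemma lkM x y S : lk (x * y) S = (lk x S + lk y (braid_perm x @: S))%R.
Proof.
elim/braid_of_ind: x => u; elim/braid_of_ind: y => v.
by rewrite -braid_of_cat !lkE braid_permE word_lk_cat.
Qed.

Lemma lk1 S : lk 1 S = 0%R.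
Proof. exact: (lkE [::]). Qed.

Lemma lkV x S : lk x^-1 S = (- lk x (braid_perm x^-1%g @: S))%R.
Proof.
by apply/eqP; rewrite -GRing.addr_eq0 -lkM mulVg lk1.
Qed.

Lemma pure_imset x S : P x -> braid_perm x @: S = S.
Proof. by move=> Px; rewrite (Px : braid_perm x = 1) imset_perm1. Qed.

Lemma lkM_pure x y S : P x -> lk (x * y) S = (lk x S + lk y S)%R.
Proof. by move=> Px; rewrite lkM pure_imset. Qed.

Lemma lkV_pure x S : P x -> lk x^-1 S = (- lk x S)%R.
Proof.
move=> Px; rewrite lkV pure_imset //.
exact: is_subgroupV (pure_subgroup n) _ Px.
Qed.

Lemma lkJ_pure x y S : P x -> lk (x ^ y) S = lk x (braid_perm y^-1 @: S).
Proof.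
move=> Px; rewrite conjgE lkM lkM_pure // lkV; set T := _ @: S.
by rewrite (GRing.addrC (lk x T)) GRing.addKr.
Qed.

Lemma lkX_pure x m S : P x -> lk (x ^+ m) S = (lk x S *+ m)%R.
Proof.
move=> Px; elim: m => [|m IHm]; first exact: lk1.
by rewrite expgS lkM_pure // IHm GRing.mulrS.
Qed.

Lemma lk_sigma2 i S :
  lk (sigma n i * sigma n i) S = ((S == strands i)%:R *+ 2)%R.
Proof.
have -> : sigma n i * sigma n i = braid_of [:: (i, false); (i, false)].
  by rewrite (braid_of_cat [:: _] [:: _]) !braid_of_letter.
rewrite lkE /= imset_perm_eq tpermV imset_set2 tpermL tpermR finset.setUC.
by rewrite -/(strands _) GRing.addr0.
Qed.

(** Each crossing of the two strands exchanges their order, and its sign does not matter modulo 2;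
    [strands_inversion] is the case of one letter. *)
Lemma lk_parity x (a b : 'I_n) : a != b ->
  odd `|lk x [set a; b]%SET|%N =
    ((a < b)%N (+) (braid_perm x a < braid_perm x b)%N).
Proof.
elim/braid_of_ind: x a b => w; elim: w => [|[i e] w IHw] a b ab.
  by rewrite lkE braid_permE /word_perm big_nil !perm1 addbb.
rewrite lkE braid_permE /word_perm big_cons !permM /=.
rewrite imset_set2 -lkE -/(word_perm w) -braid_permE.
set s := letter_perm _; have sab : s a != s b by rewrite (inj_eq perm_inj).
have := strands_inversion i ab; rewrite -[letter_perm _]/s.
have := IHw _ _ sab.
clearbody s; move: (lk _ _) => m; case: e; case: eqP => _ /=; lia.
Qed.

End LinkingNumbers.

(** * Crossing numbers of products, conjugacy of the generators *)

Section LinkingNumbersOfProducts.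
Variable n : nat.
Local Notation B := (braid_group n).
Local Notation P := (@pure_braid n).

Lemma lk_prod_pure (I : Type) (r : seq I) (F : I -> B)
    (S : {set 'I_n}) :
  (forall i, P (F i)) ->
  lk (\prod_(i <- r) F i) S = (\sum_(i <- r) lk (F i) S)%R.
Proof.
move=> PF; elim: r => [|i r IHr]; first by rewrite !big_nil lk1.
by rewrite !big_cons lkM_pure // IHr.
Qed.

Lemma lk_card (x : B) (S : {set 'I_n}) : #|S| != 2 -> lk x S = 0%R.
Proof.
elim/braid_of_ind: x S => w S; rewrite lkE.
elim: w S => [|[i b] w IHw] S //= S2.
rewrite IHw ?card_imset //; last exact: perm_inj.
case: (S =P strands i) S2 => [-> /negP[]|_ _]; last by rewrite GRing.addr0.
by rewrite cards2 strand_neq.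
Qed.

Lemma sigma_conj k : (k < n.-1)%N -> exists y, sigma n k = sigma n 0 ^ y.
Proof.
elim: k => [|k IHk] kn; first by exists 1; rewrite conjg1.
have [|y yE] := IHk; first exact: ltnW.
(* The near relation says that [sigma n k.+1 * sigma n k] conjugates [sigma n k] to
   [sigma n k.+1]. *)
exists (y * (sigma n k.+1 * sigma n k)); rewrite conjgM -yE conjgE.
by rewrite (mulgA (sigma n k)) -sigma_near // mulKg.
Qed.

Lemma braid_perm_surj (p : 'S_n) : exists x : B, braid_perm x = p.
Proof.
have [a|w _ ->] := @perm_word n n.-1 p; first by have := ltn_ord a; lia.
by exists (\prod_(k <- w) sigma n k); rewrite perm_prod.
Qed.

End LinkingNumbersOfProducts.

Lemma perm_sigma_ord n (i : 'I_n.-1) :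
  braid_perm (sigma n i) = tperm (strand i) (next_strand i).
Proof. by rewrite perm_sigma /adj valK. Qed.

(** * The abelianized pure braid group and the invariants of [B_n/[P_n, P_n]] *)

Section PureBraidAbelianization.
Variables (n : nat) (hn : (1 < n)%N).
Local Notation B := (braid_group n).
Local Notation P := (@pure_braid n).
Local Notation Q := (braid_mod_derived n).
Implicit Types (x y z : B) (S T : {set 'I_n}).

Definition proj_derived x : Q := quot_proj (derived_pure_braid n) x.
Local Notation q := proj_derived.

Lemma proj_derivedM x y : q (x * y) = q x * q y. Proof. exact: gmulfM. Qed.
Lemma proj_derived1 : q 1 = 1. Proof. exact: gmulf1. Qed.
Lemma proj_derivedV x : q x^-1 = (q x)^-1. Proof. exact: gmulfV. Qed.
Lemma proj_derivedJ x y : q (x ^ y) = q x ^ q y. Proof. exact: gmulfJ. Qed.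

(** On [P] the map [lk] is additive with values in an abelian group, so it kills commutators. *)
Lemma derived_pure_lk z :
  Defs.derived P z -> P z /\ forall S, lk z S = 0%R.
Proof.
apply: (@generated_sub _ _ [set z | P z /\ forall S, lk z S = 0%R]).
  have [P1 PM PV] := @pure_subgroup n.
  split=> /= [|x y [Px x0] [Py y0]|x [Px x0]]; split=> [|S].
  - exact: P1.
  - exact: lk1.
  - exact: PM.
  - by rewrite lkM_pure // x0 y0.
  - exact: PV.
  - by rewrite lkV x0 GRing.oppr0.
move=> _ [x [y [Px Py ->]]]; rewrite /= commgEl.
have [P1 PM PV] := @pure_subgroup n.
split=> [|S]; first by apply: PM; [apply: PV | apply: pureJ].
rewrite lkM_pure; last exact: PV.
rewrite lkV lkJ_pure // !pure_imset ?GRing.addNr //; exact: PV.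
Qed.

Lemma proj_derived_inv x y :
  q x = q y -> braid_perm x = braid_perm y /\ lk x =1 lk y.
Proof.
move/quot_projP/derived_pure_lk => [Pxy lk0].
have pxy : braid_perm x = braid_perm y.
  apply: (mulgI (braid_perm x)^-1); rewrite mulVg -braid_permV -braid_permM.
  exact: esym.
split=> // S; have := lk0 (braid_perm x @: S).
rewrite lkM lkV -!imset_permM braid_permV mulgV imset_perm1.
by move/eqP; rewrite GRing.addrC GRing.subr_eq0 => /eqP.
Qed.

Lemma proj_derived_pureC x y : P x -> P y -> commute (q x) (q y).
Proof.
move=> Px Py; apply/commgP/eqP; rewrite -gmulfR.
apply/quot_proj_eq1; apply: mem_generated; rewrite /commutators /=.
by exists x, y.
Qed.

Lemma top_lt : (n.-2 < n.-1)%N. Proof. by lia. Qed.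
(** With the last two strands, the permutations fixing both are words in an initial segment of
    generators, the form given by [perm_word]. *)
Definition top : 'I_n.-1 := Ordinal top_lt.
Definition twist : B := sigma n top * sigma n top.

Lemma twist_pure : P twist. Proof. exact: pure_sigma2. Qed.

Lemma sigma2_conj_twist i :
  exists y, sigma n i * sigma n i = if (i < n.-1)%N then twist ^ y else 1.
Proof.
case: ltnP => [i_lt|i_ge]; last first.
  by exists 1; rewrite /sigma insubF ?mulg1 // ltnNge i_ge.
have [y yE] := sigma_conj i_lt; have [z zE] := sigma_conj top_lt.
by exists (z^-1 * y); rewrite /twist zE yE -!conjMg conjgM conjgK.
Qed.

(** Up to a pure braid, [z] is a word in generators far from [top]. These commute with [twist], and
    pure braids commute with it modulo [[P, P]]. *)
Lemma twist_fixC z : braid_perm z (strand top) = strand top ->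
  braid_perm z (next_strand top) = next_strand top -> commute (q twist) (q z).
Proof.
move=> fix1 fix2.
have [a a_gt|w wk wE] := @perm_word n (n - 3)%N (braid_perm z).
  have [e|e] : a = n.-2 :> nat \/ a = n.-1 :> nat by have := ltn_ord a; lia.
    by rewrite (_ : a = strand top) //; apply: val_inj.
  rewrite (_ : a = next_strand top) //; apply: val_inj => /=; lia.
rewrite -(mulVKg (\prod_(k <- w) sigma n k) z).
rewrite [X in commute _ X]proj_derivedM.
apply: commuteM; last first.
  apply: proj_derived_pureC; first exact: twist_pure.
  rewrite /pure_braid /= /kernel /= braid_permM braid_permV perm_prod.
  by rewrite -wE mulVg.
rewrite /commute -!proj_derivedM; congr q.
elim: w wk {wE} => [|k w IHw] /=; first by rewrite big_nil mulg1 mul1g.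
case/andP=> kn wk; rewrite big_cons; apply/commuteM; last exact: IHw.
have far : commute (sigma n top) (sigma n k).
  by apply/commute_sym/sigma_far => /=; lia.
by apply/commute_sym; apply: commuteM; apply: commute_sym.
Qed.

Lemma twist_stabC z :
  braid_perm z @: strands top = strands top -> commute (q twist) (q z).
Proof.
rewrite /strands imset_set2; set a := strand top; set b := next_strand top.
set p := braid_perm z => E.
have ab : p a != p b by rewrite (inj_eq perm_inj) strand_neq.
have : p a \in [set a; b]%SET by rewrite -E !inE eqxx.
have : p b \in [set a; b]%SET by rewrite -E !inE eqxx orbT.
rewrite !inE => /orP[] /eqP pb /orP[] /eqP pa; rewrite pa pb ?eqxx // in ab;
  last exact: twist_fixC.
(* In the remaining case [z] swaps the two strands; multiplying by [sigma n top], which commutes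
   with its own square, makes it fix them. *)
have topC : commute (q twist) (q (sigma n top)).
  by rewrite /commute -!proj_derivedM /twist !mulgA.
rewrite -(mulgK (sigma n top) z) [X in commute _ X]proj_derivedM.
rewrite proj_derivedV.
apply: commuteM; last exact: commuteV.
apply: twist_fixC; rewrite braid_permM permM -/p ?pa ?pb perm_sigma_ord.
  exact: tpermR.
exact: tpermL.
Qed.



Lemma twist_conj x y :
  braid_perm x @: strands top = braid_perm y @: strands top ->
  q (twist ^ x) = q (twist ^ y).
Proof.
move=> xy.
have /twist_stabC C :
    braid_perm (x * y^-1) @: strands top = strands top.
  by rewrite braid_permM imset_permM xy -imset_permM -braid_permM mulgV
    braid_perm1 imset_perm1.
rewrite -{1}(mulgVK y x) conjgM ![q (_ ^ y)]proj_derivedJ; congr (_ ^ _).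
by rewrite proj_derivedJ conjgE C mulKg.
Qed.

(** Modulo [[P, P]], the standard pure braid generator attached to the pair [S]; by [twist_conj] its
    class does not depend on the chosen braid. *)
Definition band S : B :=
  if pselect (exists x, braid_perm x @: strands top = S) is left h
  then twist ^ projT1 (cid h) else 1.

Lemma band_pure S : P (band S).
Proof.
rewrite /band; case: pselect => h; last exact: is_subgroup1 (pure_subgroup n).
exact/pureJ/twist_pure.
Qed.

Lemma proj_band x : q (band (braid_perm x @: strands top)) = q (twist ^ x).
Proof.
rewrite /band; case: pselect => [h|[]]; last by exists x.
by case: cid => y /= /twist_conj.
Qed.

Lemma exists_braid_pair S : #|S| = 2 ->
  exists x : B, braid_perm x @: strands top = S.
Proof.
move/eqP/cards2P => [a [b [ab ->]]].
(* The first transposition sends one strand to [a]; the second sends the image of the other to [b]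
   and fixes [a]. *)
pose p := tperm (strand top) a; pose p' := tperm (p (next_strand top)) b.
have [x xE] := braid_perm_surj (p * p'); exists x.
have pa : p (strand top) = a by rewrite /p tpermL.
rewrite xE imset_permM !imset_set2 pa /p' tpermL tpermD // 1?eq_sym //.
by rewrite -[X in X != _]pa (inj_eq perm_inj) strand_neq.
Qed.

Lemma lk_band S T :
  lk (band S) T = (((#|S| == 2) && (T == S))%:R *+ 2)%R.
Proof.
rewrite /band; case: pselect => [h|noS]; last first.
  rewrite lk1; case: eqP => //= /exists_braid_pair; contradiction.
case: cid => x /= <-; rewrite lkJ_pure; last exact: twist_pure.
rewrite lk_sigma2 imset_perm_eq braid_permV invgK.
by rewrite card_imset ?cards2 ?strand_neq //; apply: perm_inj.
Qed.

Lemma band_out S : #|S| != 2 -> band S = 1.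
Proof.
rewrite /band; case: pselect => // h /negP[]; have [x <-] := h.
by rewrite card_imset ?cards2 ?strand_neq //; apply: perm_inj.
Qed.

Definition bands (a : {set 'I_n} -> nat) : B := \prod_S band S ^+ a S.

Lemma bandX_pure S m : P (band S ^+ m).
Proof.
elim: m => [|m IHm]; first exact: is_subgroup1 (pure_subgroup n).
by rewrite expgS; apply: is_subgroupM (pure_subgroup n) _ _ (band_pure S) IHm.
Qed.

Lemma bands_pure a : P (bands a).
Proof. by apply: subgroup_prod (pure_subgroup n) _ => S; apply: bandX_pure. Qed.

Lemma lk_bands a S : #|S| = 2 -> lk (bands a) S = ((a S)%:R *+ 2)%R.
Proof.
move=> S2; rewrite lk_prod_pure; last by move=> T; apply: bandX_pure.
rewrite (bigD1 S) //= big1 => [|T TS]; rewrite lkX_pure; try exact: band_pure.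
  by rewrite lk_band S2 !eqxx GRing.addr0 GRing.mulrnAC.
by rewrite lk_band [S == T]eq_sym (negPf TS) andbF !GRing.mul0rn.
Qed.

Lemma proj_bandsD a b :
  q (bands (fun S => a S + b S)%N) = q (bands a) * q (bands b).
Proof.
have qE c : q (bands c) = \prod_S q (band S) ^+ c S.
  rewrite [LHS]gmulf_prod; apply: eq_bigr => S _.
  exact: (gmulfXn (quot_proj (derived_pure_braid n))).
rewrite !qE -prodgM_commute => [|S T _ _].
  by apply: eq_bigr => S _; rewrite expgnDr.
by apply: commuteX2; apply: proj_derived_pureC; apply: band_pure.
Qed.

(** The exponents in [bands] are natural numbers, hence the quotient of two products. Such quotients
    form a subgroup because [P/[P, P]] is abelian, and it contains the classes of the generators of
    [P]. *)
Lemma pure_bands :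
  P `<=` [set x | exists a b, q x = q (bands a) * (q (bands b))^-1].
Proof.
move=> x /pure_generated; move: x; apply: generated_sub.
  have C a b : commute (q (bands a)) (q (bands b)).
    by apply: proj_derived_pureC; apply: bands_pure.
  split=> /=.
  - by exists (fun=> 0), (fun=> 0); rewrite mulgV proj_derived1.
  - move=> x y [a [b xE]] [a' [b' yE]].
    exists (fun S => a S + a' S)%N, (fun S => b S + b' S)%N.
    rewrite proj_derivedM xE yE !proj_bandsD (C b) invgM !mulgA; congr (_ * _).
    rewrite -!mulgA; congr (_ * _).
    exact/commute_sym/commuteV.
  - move=> x [a [b xE]]; exists b, a.
    by rewrite proj_derivedV xE invgM invgK.
move=> _ [k [x ->]] /=; have [y ->] := sigma2_conj_twist k.
case: ifP => _; last first.
  exists (fun=> 0), (fun=> 0).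
  by rewrite conj1g mulgV proj_derived1.
(* By [proj_band], the conjugated twist is the single band at the pair to which [y * x] carries the
   top strands. *)
exists (fun S => S == braid_perm (y * x) @: strands top : nat), (fun=> 0).
rewrite -conjgM -proj_band -proj_derivedV -proj_derivedM; congr q.
rewrite /bands [X in _ * X^-1]big1 // invg1 mulg1.
set S0 := _ @: _.
rewrite (eq_bigr (fun S => if S == S0 then band S else 1)) => [|S _].
  by rewrite -big_mkcond big_pred1_eq.
by case: eqP.
Qed.

(** The class of the pure braid [x^-1 * y] is a quotient of products of bands, whose exponents are
    recovered from [lk]. *)
Lemma proj_derived_inj x y :
  braid_perm x = braid_perm y -> lk x =1 lk y -> q x = q y.
Proof.
move=> pxy lxy; apply: (mulgI (q x)^-1).
rewrite mulVg -proj_derivedV -proj_derivedM.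
have Pz : P (x^-1 * y).
  by rewrite /pure_braid /= /kernel /= braid_permM braid_permV pxy mulVg.
have [a [b zE]] := pure_bands Pz.
have /proj_derived_inv[_ lkz] : q (x^-1 * y) = q (bands a * (bands b)^-1).
  by rewrite zE proj_derivedM proj_derivedV.
rewrite zE (_ : bands a = bands b) ?mulgV //.
apply: eq_bigr => S _; have [S2|S2] := eqVneq #|S| 2; last first.
  by rewrite band_out // !expg1n.
congr (_ ^+ _); have := lkz S.
rewrite [lk (x^-1 * y) S]lkM lkV lxy GRing.addNr.
rewrite lkM_pure ?lkV_pure ?lk_bands //; try exact: bands_pure.
by rewrite !natz; lia.
Qed.

(** Any braid over [p] has crossing numbers congruent to [v] modulo 2 by [lk_parity]; bands, each
    counting 2 at its own pair, correct the even difference. *)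
Lemma exists_braid (p : 'S_n) (v : {set 'I_n} -> int) :
  (forall a b : 'I_n, a != b ->
    odd `|v [set a; b]%SET|%N = ((a < b)%N (+) (p a < p b)%N)) ->
  (forall S, #|S| != 2 -> v S = 0%R) ->
  exists x, braid_perm x = p /\ lk x =1 v.
Proof.
move=> v_odd v0; have [x xp] := braid_perm_surj p.
pose d S := (v S - lk x S)%R.
(* Positive and negative parts of half the difference. *)
pose a S := if (0 <= d S)%R then `|d S|%N./2 else 0.
pose b S := if (0 <= d S)%R then 0 else `|d S|%N./2.
have Pa := bands_pure a; have Pb := bands_pure b.
have PbV := is_subgroupV (pure_subgroup n) Pb.
have Pab := is_subgroupM (pure_subgroup n) Pa PbV.
exists (bands a * (bands b)^-1 * x); split=> [|S].
  by rewrite braid_permM (Pab : braid_perm _ = 1) mul1g.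
have [S2|S2] := eqVneq #|S| 2; last by rewrite lk_card // v0.
rewrite lkM_pure // lkM_pure // lkV_pure // !lk_bands //.
have /cards2P[s [t [st SE]]] : #|S| == 2 by rewrite S2.
have := v_odd s t st; rewrite -xp -lk_parity // -SE /a /b /d.
by rewrite !natz; case: ifP; lia.
Qed.

Lemma proj_derived_surj (u : Q) : exists x, q x = u.
Proof. by exists (repr u); rewrite /proj_derived /quot_proj reprK. Qed.

Lemma proj_derived_torsion x m :
  P x -> (0 < m)%N -> q (x ^+ m) = 1 -> q x = 1.
Proof.
move=> Px m_gt0; rewrite -proj_derived1 => /proj_derived_inv[_ xm].
apply: proj_derived_inj => [|S]; first by rewrite braid_perm1.
have /eqP := xm S; rewrite lkX_pure // !lk1 Num.Theory.mulrn_eq0.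
by rewrite eqn0Ngt m_gt0 => /eqP.
Qed.

Lemma proj_derived_involution x : q (x * x) = 1 -> q x = 1.
Proof.
move=> xx; have [px|px] := eqVneq (braid_perm x) 1.
  exact: (@proj_derived_torsion x 2).
move: xx; rewrite -proj_derived1 => /proj_derived_inv[].
rewrite braid_permM braid_perm1; set p := braid_perm x => pp lkxx.
have [a pa] : exists a, p a != a.
  apply/existsP; apply: contra_neqT px; rewrite negb_exists => /forallP fix_p.
  by apply/permP => a; rewrite perm1; apply/eqP; have := fix_p a; rewrite negbK.
have ppa : p (p a) = a by rewrite -permM pp perm1.
(* Since [p] preserves the pair [{a, p a}], [lk] of [x * x] there is twice that of [x], which must
   vanish; yet it is odd, as [p] reverses the pair. *)
have := lkxx [set a; p a]%SET.
rewrite lkM lk1 -/p imset_set2 ppa (finset.setUC [set p a]).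
have := @lk_parity _ x a (p a); rewrite eq_sym => /(_ pa); rewrite -/p ppa.
move=> odd_lk /eqP; rewrite -GRing.mulr2n Num.Theory.mulrn_eq0 /= => /eqP lk0.
move: odd_lk; rewrite lk0; case: ltngtP => // /val_inj/esym/eqP.
by rewrite (negPf pa).
Qed.

End PureBraidAbelianization.

(** * Invariant orientations for groups of odd order *)

Section InvariantOrientation.
Variables (n : nat) (A : finGroupType) (r : A -> 'S_n).
Hypotheses (oddA : odd #|A|) (rM : {morph r : a b / a * b}).
Implicit Types (a b : A) (s t : 'I_n) (S : {set 'I_n}).

Definition pair_orbit s t : {set 'I_n * 'I_n} :=
  [set (r a s, r a t) | a : A]%SET.

(* Since [A] has odd order, no element of [A] swaps two points, so comparing
   the orbits of (s, t) and (t, s) orients the pair {s, t} invariantly. *)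
Definition oriented s t : bool :=
  (enum_rank (pair_orbit s t) < enum_rank (pair_orbit t s))%N.

Lemma pair_orbit_act a s t : pair_orbit (r a s) (r a t) = pair_orbit s t.
Proof.
apply/setP => u; apply/imsetP/imsetP => -[b _ ->].
  by exists (a * b); rewrite // rM !permM.
by exists (a^-1 * b); rewrite // -!permM -!rM mulKVg.
Qed.

(** If [a] swaps [s] and [t], then [a ^+ 2] fixes [s]; the order of [a] being odd, [a] is a power of
    [a ^+ 2] and fixes [s] too, so [s = t]. *)
Lemma pair_orbit_swap s t : s != t -> pair_orbit s t != pair_orbit t s.
Proof.
apply: contra_neq => st.
have r1 : r 1 = 1 by apply: (mulgI (r 1)); rewrite -rM !mulg1.
have : (t, s) \in pair_orbit s t.
  by rewrite st; apply/imsetP; exists 1; rewrite // r1 !perm1.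
case/imsetP => a _ [ts sat].
have fix_a2 k : r ((a ^+ 2) ^+ k) s = s.
  elim: k => [|k IHk]; first by rewrite r1 perm1.
  by rewrite expgS rM permM expg2 rM permM -ts -sat.
have odd_a : odd #[a].
  by apply: dvdn_odd oddA; rewrite -cardsT; apply: order_dvdG; rewrite inE.
rewrite ts -[LHS](fix_a2 (#[a].+1)./2) -expgnA mul2n.
have -> : ((#[a].+1)./2.*2 = #[a].+1)%N.
  by rewrite -[RHS]odd_double_half /= odd_a.
by rewrite expgS expg_order mulg1.
Qed.

Lemma orientedC s t : s != t -> oriented t s = ~~ oriented s t.
Proof.
move/pair_orbit_swap; rewrite -(inj_eq enum_rank_inj) -(inj_eq val_inj).
rewrite /oriented /=; lia.
Qed.

Lemma oriented_act a s t : oriented (r a s) (r a t) = oriented s t.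
Proof. by rewrite /oriented !pair_orbit_act. Qed.

(** Which orientation counts as the defect is a convention: the opposite one would only change the
    sign of [defect_cocycle] on pairs. *)
Definition order_defect S : bool :=
  [exists s : 'I_n, exists t : 'I_n,
    [&& (s < t)%N, S == [set s; t]%SET & oriented s t]].

Lemma order_defectE s t : s != t ->
  order_defect [set s; t]%SET = ~~ ((s < t)%N (+) oriented s t).
Proof.
wlog st : s t / (s < t)%N.
  move=> h ne; have [st|ts|e] := ltngtP s t; first by rewrite h // st.
    by rewrite finset.setUC h 1?eq_sym // ts orientedC //= negbK.
  by move: ne; rewrite (val_inj e) eqxx.
move=> ne; rewrite st addTb negbK; apply/idP/idP => [|or].
  case/existsP => s' /existsP[t' /and3P[st' /eqP E]].
  have : s \in [set s'; t']%SET by rewrite -E !inE eqxx.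
  have : t \in [set s'; t']%SET by rewrite -E !inE eqxx orbT.
  rewrite !inE => /orP[] /eqP tE /orP[] /eqP sE; move: ne st st';
    by rewrite sE tE ?eqxx // ltnNge => _ /negP + /ltnW.
by apply/existsP; exists s; apply/existsP; exists t; rewrite st eqxx.
Qed.

(** A coboundary: in the semidirect product it conjugates the plain copy of the permutations [r a]
    by [order_defect]. *)
Definition defect_cocycle a S : int :=
  ((order_defect (r a @: S))%:R - (order_defect S)%:R)%R.

Lemma defect_cocycleM a b S :
  defect_cocycle (a * b) S =
    (defect_cocycle a S + defect_cocycle b (r a @: S))%R.
Proof. by rewrite /defect_cocycle rM imset_permM; ring. Qed.

(** Modulo 2 the two orientation terms cancel by invariance, leaving the change in the standard
    order. *)
Lemma defect_cocycle_parity a s t : s != t ->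
  odd `|defect_cocycle a [set s; t]%SET|%N = ((s < t)%N (+) (r a s < r a t)%N).
Proof.
move=> st; rewrite /defect_cocycle imset_set2 !order_defectE;
  rewrite ?(inj_eq perm_inj) //.
rewrite oriented_act; case: (oriented s t); lia.
Qed.

Lemma defect_cocycle_card a S : #|S| != 2 -> defect_cocycle a S = 0%R.
Proof.
have defect0 (T : {set 'I_n}) : #|T| != 2 -> order_defect T = false.
  apply: contraNF => /existsP[s /existsP[t /and3P[st /eqP -> _]]].
  have ne : s != t by rewrite -(inj_eq val_inj) /= ltn_eqF.
  by rewrite cards2 ne.
move=> S2; rewrite /defect_cocycle !defect0 ?card_imset //.
exact: perm_inj.
Qed.

End InvariantOrientation.

(** * The correspondence of finite abelian subgroups *)

Lemma isomorphic_to_subgroup_inj (A G : groupType) (F : A -> G) :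
  {morph F : a b / a * b} -> injective F -> isomorphic_to_subgroup A G.
Proof.
move=> FM F_inj; pose m := isMultiplicative.Build A G F FM.
pose f : {multiplicative A -> G} := HB.pack F m.
have F1 : F 1 = 1 by apply: (mulgI (F 1)); rewrite -FM !mulg1.
exists (range f); split; last by exists f.
split=> [|_ _ [a _ <-] [b _ <-]|_ [a _ <-]].
- by exists 1.
- by exists (a * b) => //; rewrite /= FM.
- by exists a^-1 => //; apply: (mulgI (F a)); rewrite /= -FM !mulgV.
Qed.

Local Close Scope classical_set_scope.

Theorem theorem6 (n : nat) (hn : 3 <= n) (A : finGroupType)
    (hA : abelian [set: A]) :
  isomorphic_to_subgroup A (braid_mod_derived n) <->
  odd #|A| /\ exists H : {group 'S_n}, [set: A]%G \isog H.
Proof.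
have n_gt1 : (1 < n)%N by apply: ltnW.
split=> [[_ [_ [f [f_inj _]]]]|[oddA [H /isogP[r /injmP r_inj _]]]].
  have fM a b : f (a * b) = f a * f b by exact: gmulfM.
  have f1 : f 1 = 1 by apply: (mulgI (f 1)); rewrite -fM !mulg1.
  have [X XE] := choice (fun a => proj_derived_surj (f a)).
  have f_eq1 a : f a = 1 -> a = 1 by rewrite -f1 => /f_inj.
  have fX a m : f (a ^+ m) = proj_derived (X a ^+ m).
    elim: m => [|m IHm]; first by rewrite proj_derived1.
    by rewrite !expgS proj_derivedM fM IHm XE.
  split.
    (* An even order would give, by Cauchy, an element of order 2, excluded by
       [proj_derived_involution]. *)
    apply: contraT; rewrite -dvdn2 -cardsT.
    case/(Cauchy (isT : prime 2)) => a _ a2.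
    have : a = 1.
      apply: f_eq1; rewrite -XE; apply: (proj_derived_involution n_gt1).
      by rewrite -[_ * _]/(X a ^+ 2) -fX -a2 expg_order.
    by move=> a1; rewrite a1 order1 in a2.
  pose p a := braid_perm (X a).
  have pM : {in [set: A]%SET &, {morph p : a b / a * b}}.
    move=> a b _ _; rewrite /p -braid_permM.
    by apply: (proj1 (@proj_derived_inv n _ _ _)); rewrite proj_derivedM !XE fM.
  exists (Morphism pM @* [set: A])%G; apply: sub_isog => //.
  (* The kernel is trivial: an element inducing the identity permutation lifts to a pure braid whose
     class has finite order. *)
  apply/fintype.subsetP => a /morphpreP[_]; rewrite !inE => /eqP pa.
  apply/eqP/f_eq1; rewrite -XE.
  apply: (proj_derived_torsion n_gt1 (m := #[a])) => //.
  by rewrite -fX expg_order.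
have rM : {morph r : a b / a * b} by move=> a b; apply: morphM; rewrite inE.
have lift a : exists x : braid_group n,
    braid_perm x = r a /\ lk x =1 defect_cocycle r a.
  apply: (exists_braid n_gt1) => [s t|S].
    exact: defect_cocycle_parity.
  exact: defect_cocycle_card.
have [X XE] := choice lift.
(* The class of a lift is determined by its permutation and [lk], so multiplicativity reduces to the
   cocycle identity. *)
apply: (@isomorphic_to_subgroup_inj _ _ (fun a => proj_derived (X a))).
  move=> a b; rewrite -proj_derivedM.
  have [pab lab] := XE (a * b); have [pa la] := XE a; have [pb lb] := XE b.
  apply: (proj_derived_inj n_gt1) => [|S].
    by rewrite braid_permM pab rM pa pb.
  by rewrite lab lkM pa la lb; apply: defect_cocycleM.
move=> a b /proj_derived_inv[]; have [-> _] := XE a; have [-> _] := XE b.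
by move=> rab _; apply: r_inj; rewrite ?inE.
Qed.
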